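(* There is an absolute constant $C>0$ such that for all integers $k\ge 2$ and all positive integers $n_1\ge n_2\ge\dots\ge n_k$, $$c^{\mathrm{PROP}}(n_1,\dots,n_k)\ \ge\ C\cdot\max_{i^*\in\{1,\dots,k\}}\ \frac{i^*}{k}\cdot\sqrt{n_{i^*}}.$$
   Context: There is a finite set $G$ of items (goods) and $k$ groups of agents of sizes $n_1,\dots,n_k$. The $j$-th agent of group $i$ has a utility function $u^{(i,j)}$ on subsets of $G$ that is monotone and additive: $u^{(i,j)}(S)=\sum_{g\in S}u^{(i,j)}(g)$ for all $S\subseteq G$, with $u^{(i,j)}(g)\ge 0$ for all $g\in G$. An allocation $A=(A_1,\dots,A_k)$ is a partition of $G$ into $k$ (possibly empty) bundles, where $A_i$ is allocated to group $i$. For a nonnegative integer $c$, $A$ is proportional up to $c$ goods (PROP$c$) if for all $i\in\{1,\dots,k\}$ and $j\in\{1,\dots,n_i\}$ there is a set $B\subseteq G\setminus A_i$ with $|B|\le c$ such that $u^{(i,j)}(A_i)\ge u^{(i,j)}(G)/k-u^{(i,j)}(B)$. $c^{\mathrm{PROP}}(n_1,\dots,n_k)$ is the smallest $c$ such that, for every finite set $G$ of goods and every choice of monotone additive utilities of the agents, a PROP$c$ allocation exists. *)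

(* Defs.v *)
From HB Require Import structures.
From mathcomp Require Import all_boot all_order all_algebra.
From mathcomp Require Import all_classical all_reals ereal.

Set Implicit Arguments.
Unset Strict Implicit.
Unset Printing Implicit Defensive.

Import Order.TTheory GRing.Theory Num.Theory.
Local Open Scope ring_scope.

(* Groups are indexed from 0, so group i : 'I_k is group number i.+1 on paper;
   the agents of group i are the elements of 'I_(n i). *)

Definition monotone_additive (R : realType) (G : finType)
    (v : {set G} -> R) : Prop :=
  (forall g : G, 0 <= v [set g]) /\
  (forall S : {set G}, v S = \sum_(g in S) v [set g]).

(* Bundles may be empty, so [finset.partition] is not applicable. *)
Definition is_allocation (k : nat) (G : finType)
    (A : 'I_k -> {set G}) : Prop :=
  (forall i j : 'I_k, i != j -> [disjoint A i & A j]) /\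
  \bigcup_(i < k) A i = [set: G].

Definition PROP_up_to (R : realType) (k : nat) (n : 'I_k -> nat) (G : finType)
    (u : forall i : 'I_k, 'I_(n i) -> {set G} -> R)
    (A : 'I_k -> {set G}) (c : nat) : Prop :=
  forall (i : 'I_k) (j : 'I_(n i)),
    exists B : {set G},
      [/\ B \subset ~: A i, (#|B| <= c)%N &
          u i j (A i) >= u i j [set: G] / k%:R - u i j B].

Definition PROP_guaranteed (R : realType) (k : nat) (n : 'I_k -> nat)
    (c : nat) : Prop :=
  forall (G : finType) (u : forall i : 'I_k, 'I_(n i) -> {set G} -> R),
    (forall (i : 'I_k) (j : 'I_(n i)), monotone_additive (u i j)) ->
    exists A : 'I_k -> {set G}, is_allocation A /\ PROP_up_to u A c.

(* The smallest c, as an infimum of a set of natural numbers in the extended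
   reals: it is the minimum of that set when the set is nonempty, and would be
   +oo otherwise. *)
Definition cPROP (R : realType) (k : nat) (n : 'I_k -> nat) : \bar R :=
  ereal_inf [set (c%:R%:E : \bar R) | c in PROP_guaranteed R n]%classic.

(* Main.v *)
Require Import Defs.
From HB Require Import structures.
From mathcomp Require Import all_boot all_order all_algebra.
From mathcomp Require Import all_classical all_reals ereal.
From mathcomp Require Import ring lra zify.

Set Implicit Arguments.
Unset Strict Implicit.
Unset Printing Implicit Defensive.

Import Order.TTheory GRing.Theory Num.Theory.
Local Open Scope ring_scope.

(** Let [p] be the 1-based index [i*] of the paper; each of the first [p] groups
    has at least [n_{i*}] agents. Take the rows of a Sylvester-Hadamard matrix
    of order [N], with [2N <= n_{i*} < 4N], and repeat every column
    [r = floor(k/2)] times; the columns are the goods. In each of the first [p]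
    groups (when [n_{i*} >= 2], the other case being trivial) two agents per row
    value the positive, resp. the negative, entries of that row; the agents of
    the other groups value all goods equally. Since the latter groups take
    their shares up to [c] goods each, one of the first [p] bundles has at most
    [|G|/k + (k-p)c/p] goods, so each row has discrepancy at most [2ck/p] on it.
    The number of copies of a column in this bundle is an integer, hence at
    distance at least [1/3] from its target [r/k], which lies in [[1/3,1/2]],
    and by orthogonality some row has discrepancy at least [sqrt N / 3]. *)

(** Sylvester doubling, with signs stored as booleans: the new matrix has blocks H, H, H, -H. If P
    and Q are the pairings of a row of H with the two halves of z, the doubled rows give Q + P and Q
    - P, whose squares sum to 2P^2 + 2Q^2. *)
Lemma sylvester_parseval (R : comPzRingType) (t : nat) :
  exists (T : finType) (H : T -> T -> bool),
    #|T| = (2 ^ t)%N /\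
    forall z : T -> R,
      \sum_j (\sum_g (-1) ^+ H j g * z g) ^+ 2 =
      (2 ^ t)%:R * \sum_g z g ^+ 2.
Proof.
elim: t => [|t [T [H [cT HP]]]].
  exists unit, (fun _ _ => false); split; first by rewrite card_unit.
  by move=> z; rewrite !(big_pred1 tt) ?mul1r // => -[].
have pairE (F : bool * T -> R) :
    \sum_x F x = \sum_j (F (true, j) + F (false, j)).
  transitivity (\sum_(b : bool) \sum_j F (b, j)); last first.
    by rewrite big_bool -big_split.
  by rewrite pair_bigA; apply: eq_bigr => -[].
exists (bool * T)%type, (fun x y => (x.1 && y.1) (+) H x.2 y.2); split.
  by rewrite card_prod card_bool cT expnS.
move=> z; rewrite !pairE.
set P := fun j => \sum_g (-1) ^+ H j g * z (true, g).
set Q := fun j => \sum_g (-1) ^+ H j g * z (false, g).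
transitivity (\sum_j (2%:R * P j ^+ 2 + 2%:R * Q j ^+ 2)).
  apply: eq_bigr => j _; rewrite !pairE /= !big_split /= -/(Q j) -/(P j).
  under eq_bigr do rewrite signrN mulNr.
  rewrite sumrN -/(P j); ring.
by rewrite !big_split -!mulr_sumr !HP expnS natrM /=; ring.
Qed.

(** Lower bounds alone suffice: if a and b are the sums of z over the two halves of a row, then a -
    b = (a + b) - 2b <= D + 2c, and symmetrically. Summing the squares over all N rows and
    cancelling N leaves only the sum of the z g ^+ 2, which is at least N d. *)
Lemma one_sided_discrepancy (R : realDomainType) (T : finType)
    (H : T -> T -> bool) (z : T -> R) (N c D d : R) :
  #|T|%:R = N -> 0 < N -> 0 <= d ->
  \sum_j (\sum_g (-1) ^+ H j g * z g) ^+ 2 = N * \sum_g z g ^+ 2 ->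
  (forall j (b : bool), - c <= \sum_(g | H j g == b) z g) ->
  \sum_g z g <= D ->
  (forall g, d <= z g ^+ 2) ->
  N * d <= (D + 2 * c) ^+ 2.
Proof.
move=> cT N0 d0 HP zc zD zd.
have sq j : (\sum_g (-1) ^+ H j g * z g) ^+ 2 <= (D + 2 * c) ^+ 2.
  have E : \sum_g (-1) ^+ H j g * z g =
      \sum_(g | H j g == false) z g - \sum_(g | H j g == true) z g.
    rewrite (bigID (H j)) /= addrC -sumrN; congr (_ + _).
      apply: eq_big => [g|g /negPf->]; first by case: (H j g).
      by rewrite mul1r.
    by apply: eq_big => [g|g ->]; [case: (H j g) | rewrite mulN1r].
  have S : \sum_g z g =
      \sum_(g | H j g == false) z g + \sum_(g | H j g == true) z g.
    rewrite (bigID (H j)) /= addrC; congr (_ + _);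
    by apply: eq_bigl => g; case: (H j g).
  move: (zc j false) (zc j true) zD; rewrite E S.
  set a := \sum_(g | _ == false) _; set b := \sum_(g | _ == true) _.
  move=> ha hb hD; rewrite -subr_ge0 subr_sqr mulr_ge0 //; lra.
have : N * \sum_g z g ^+ 2 <= N * (D + 2 * c) ^+ 2.
  rewrite -HP -cT mulr_natl -sumr_const; exact: ler_sum.
rewrite ler_pM2l // => h; apply: le_trans h.
rewrite -cT mulr_natl -sumr_const; exact: ler_sum.
Qed.

(** Here agent (i, j) counts the goods of [F i j] received; a good is worth at most 1, so the set B
    makes up for at most c. *)
Lemma PROP_guaranteed_sets (R : realType) (k : nat) (n : 'I_k -> nat) (c : nat)
    (G : finType) (F : forall i, 'I_(n i) -> {set G}) :
  PROP_guaranteed R n c ->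
  exists2 A : 'I_k -> {set G}, is_allocation A &
    forall i (j : 'I_(n i)),
      #|F i j|%:R / k%:R - c%:R <= #|A i :&: F i j|%:R :> R.
Proof.
move=> /(_ G (fun i j S => #|S :&: F i j|%:R)) [].
  move=> i j; split=> [g|S]; first exact: ler0n.
  rewrite -natr_sum; congr _%:R; rewrite -sum1_card.
  under eq_bigl do rewrite inE.
  rewrite big_mkcondr; apply: eq_bigr => g _.
  case: ifPn => gF.
    by rewrite (finset.setIidPl _) ?cards1 // finset.sub1set.
  by rewrite (_ : _ :&: _ = finset.set0) ?cards0 //; apply/setP=> x;
    rewrite !inE; case: eqP => // ->; apply/negbTE.
move=> A [Aall AP]; exists A => // i j.
have [B [_ Bc]] := AP i j; rewrite finset.setTI; apply: le_trans.
rewrite lerD2l lerN2 ler_nat (leq_trans _ Bc) //.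
by rewrite subset_leq_card // finset.subsetIl.
Qed.

(** With a single good and c = 0, two groups would both have to own it. *)
Lemma PROP_guaranteed_gt0 (R : realType) (k : nat) (n : 'I_k -> nat) (c : nat) :
  (2 <= k)%N -> (forall i, (0 < n i)%N) -> PROP_guaranteed R n c -> (0 < c)%N.
Proof.
move=> k2 n0 Pc; rewrite lt0n; apply/eqP=> c0; move: Pc; rewrite c0.
have k0 : 0 < k%:R :> R by rewrite ltr0n; lia.
case/(PROP_guaranteed_sets (fun i _ => [set: unit])) => A [Adis _] AP.
have At i : tt \in A i.
  have := AP i (Ordinal (n0 i)); rewrite finset.setIT cardsT card_unit subr0.
  move=> /(lt_le_trans (divr_gt0 ltr01 k0)).
  by rewrite ltr0n card_gt0 => /set0Pn[[]].
have := Adis (Ordinal (ltnW k2)) (Ordinal k2) isT.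
by move/disjointFr/(_ (At _)); rewrite At.
Qed.

Lemma allocation_card (k : nat) (G : finType) (A : 'I_k -> {set G}) :
  is_allocation A -> (\sum_i #|A i|)%N = #|G|.
Proof.
case=> Adis Acov; rewrite -cardsT -Acov.
under eq_bigr do rewrite -sum1_card.
rewrite -sum1_card; apply/esym/partition_disjoint_bigcup.
exact: Adis.
Qed.

(** Otherwise replacing every summand by its lower bound gives a total strictly below m (strictness
    already at [i0]), yet these bounds add up to exactly m. *)
Lemma exists_small_summand (R : realFieldType) (k : nat) (s : 'I_k -> R)
    (m c : R) (i0 : 'I_k) :
  \sum_i s i = m ->
  (forall i : 'I_k, (i0 < i)%N -> m / k%:R - c <= s i) ->
  exists2 i : 'I_k, (i <= i0)%N &
    s i <= m / k%:R + (k%:R - i0.+1%:R) * c / i0.+1%:R.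
Proof.
move=> sm sc; set b := m / k%:R + (k%:R - i0.+1%:R) * c / i0.+1%:R.
have [/existsP[i /andP[? ?]]|/existsPn none] :=
  boolP [exists i : 'I_k, (i <= i0)%N && (s i <= b)]; first by exists i.
have p0 : i0.+1%:R != 0 :> R by rewrite pnatr_eq0.
have k0 : k%:R != 0 :> R.
  by rewrite pnatr_eq0; case: (k) i0 {p0 sc none b} => [[]|].
have : \sum_(i < k) (if (i <= i0)%N then b else m / k%:R - c) < \sum_i s i.
  have le (i : 'I_k) : (if (i <= i0)%N then b else m / k%:R - c) <= s i.
    have := none i; case: (leqP i i0) => [_|/sc //].
    by rewrite /= -ltNge => /ltW.
  rewrite [ltLHS](bigD1 i0) //= [ltRHS](bigD1 i0) //= leqnn.
  apply: ltr_leD; last exact: ler_sum.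
  by have := none i0; rewrite leqnn -ltNge.
have -> : \sum_(i < k) (if (i <= i0)%N then b else m / k%:R - c) =
    i0.+1%:R * b + (k%:R - i0.+1%:R) * (m / k%:R - c).
  rewrite -(big_mkord xpredT (fun i => if (i <= i0)%N then b else _)).
  rewrite (big_cat_nat (n := i0.+1)) //=.
  rewrite -natrB // !mulr_natl -{3}[i0.+1]subn0 -!sumr_const_nat.
  congr (_ + _); apply: eq_big_nat => i; first by rewrite ltnS => /andP[_ ->].
  by move=> /andP[h _]; rewrite leqNgt h.
rewrite sm (_ : _ + _ = m) ?ltxx // /b; field; exact/andP.
Qed.

Lemma card_fst_fibers (T1 T2 : finType) (A : {set T1 * T2}) (P : pred T1) :
  #|A :&: [set x | P x.1]| = (\sum_(t | P t) #|[set x in A | x.1 == t]|)%N.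
Proof.
rewrite -sum1_card (partition_big (fun x => x.1) P) /=; last first.
  by move=> x; rewrite !inE => /andP[].
apply: eq_bigr => t Pt; rewrite -sum1_card; apply: eq_bigl => x.
by rewrite !inE; case: eqP => [->|]; rewrite ?Pt ?andbT ?andbF.
Qed.

Lemma card_fst_preim (T1 T2 : finType) (P : pred T1) :
  #|[set x : T1 * T2 | P x.1]| = (\sum_(t | P t) #|T2|)%N.
Proof.
rewrite -[X in #|pred_of_set X|]finset.setTI card_fst_fibers.
apply: eq_bigr => t _.
have inj : injective (fun y : T2 => (t, y)) by move=> y y' [].
rewrite -(card_imset predT inj); apply: eq_card => -[x y].
rewrite !inE /=; apply/eqP/imsetP => [->|[y' _ [-> _]]//].
by exists y.
Qed.

(** The ratio lies in [1/3, 1/2], with 1/3 attained at k = 3; so y = 0 is at distance at least 1/3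
    and y >= 1 at distance at least 1/2. *)
Lemma sqr_dist_half_ratio (R : realFieldType) (k y : nat) :
  (2 <= k)%N -> 9^-1 <= (y%:R - k./2%:R / k%:R) ^+ 2 :> R.
Proof.
move=> k2; have k0 : 0 < k%:R :> R by rewrite ltr0n; lia.
have lo : 3^-1 <= k./2%:R / k%:R :> R.
  rewrite ler_pdivlMr // mulrC ler_pdivrMr // -natrM ler_nat; lia.
have hi : k./2%:R / k%:R <= 2^-1 :> R.
  rewrite ler_pdivrMr // mulrC ler_pdivlMr // -natrM ler_nat; lia.
move: lo hi; set x := _ / _ => lo hi.
have sq (d : R) : 3^-1 <= d -> 9^-1 <= d ^+ 2.
  move=> hd; rewrite (_ : 9^-1 = 3^-1 ^+ 2); last by field.
  by rewrite lerXn2r ?nnegrE ?(le_trans _ hd) ?invr_ge0.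
case: y => [|y]; first by rewrite sub0r sqrrN sq.
have y0 : 0 <= y%:R :> R by [].
by rewrite -(natr1 y) sq //; lra.
Qed.

Lemma PROP_lower_bound (R : realType) (k : nat) (n : 'I_k -> nat) (c t : nat)
    (i0 : 'I_k) :
  (2 <= k)%N -> (forall i, (0 < n i)%N) ->
  (forall i : 'I_k, (i <= i0)%N -> (2 ^ t.+1 <= n i)%N) ->
  PROP_guaranteed R n c ->
  (2 ^ t)%:R / 9 <= (2 * c%:R * k%:R / i0.+1%:R) ^+ 2 :> R.
Proof.
move=> k2 n0 nt Pc.
have [T [H [cT HP]]] := sylvester_parseval R t.
pose S (x : T * bool) := [set g : T * 'I_(k./2) | H x.1 g.1 == x.2].
(* Agents in excess of the 2^(t+1) half-rows get the [nth] default, the set of all goods. *)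
pose F (i : 'I_k) (j : 'I_(n i)) :=
  if (i <= i0)%N then nth [set: _] [seq S x | x <- enum {: T * bool}] j
  else [set: _].
have [A Aall AP] := PROP_guaranteed_sets F Pc.
pose m : R := #|{: T * 'I_(k./2)}|%:R.
have sm : \sum_i #|A i|%:R = m by rewrite -natr_sum allocation_card.
have sc (i : 'I_k) : (i0 < i)%N -> m / k%:R - c%:R <= #|A i|%:R.
  by move=> hi; have := AP i (Ordinal (n0 i));
    rewrite /F leqNgt hi /= cardsT finset.setIT.
have [i ii0 Ai] := exists_small_summand sm sc.
have AS x : #|S x|%:R / k%:R - c%:R <= #|A i :&: S x|%:R :> R.
  have xs : (index x (enum {: T * bool}) < size (enum {: T * bool}))%N.
    by rewrite index_mem mem_enum.
  have xn : (index x (enum {: T * bool}) < n i)%N.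
    apply: leq_trans xs (leq_trans _ (nt i ii0)).
    by rewrite -cardE card_prod card_bool cT expnS mulnC.
  have := AP i (Ordinal xn); rewrite /F ii0 (nth_map x) //= nth_index //.
  by rewrite mem_enum.
(* Surplus of copies of column g in the small bundle over the proportional share. *)
pose z g : R := #|[set x in A i | x.1 == g]|%:R - k./2%:R / k%:R.
have zE (P : pred T) : \sum_(g | P g) z g =
    #|A i :&: [set x | P x.1]|%:R -
    #|[set x : T * 'I_(k./2) | P x.1]|%:R / k%:R.
  by rewrite card_fst_fibers card_fst_preim card_ord !natr_sum mulr_suml -sumrB.
have k0 : 0 < k%:R :> R by rewrite ltr0n; lia.
have := @one_sided_discrepancy R T H z (2 ^ t)%:R c%:R
  ((k%:R - i0.+1%:R) * c%:R / i0.+1%:R) 9^-1.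
rewrite (_ : _ + 2 * _ = c%:R + c%:R * k%:R / i0.+1%:R); last first.
  by field; rewrite addrC natr1 pnatr_eq0.
move=> h; apply: le_trans (h _ _ _ _ _ _ _) _.
- by rewrite cT.
- by rewrite ltr0n expn_gt0.
- by rewrite invr_ge0.
- exact: HP.
- by move=> j b; rewrite zE; have := AS (j, b); rewrite /S /=; lra.
- rewrite zE (_ : [set x | _] = [set: _]); last by apply/setP=> x; rewrite !inE.
  by rewrite finset.setIT cardsT lerBlDl; exact: Ai.
- by move=> g; exact: sqr_dist_half_ratio.
(* Since k/p >= 1 for p = [i0.+1], the bound c + ck/p is at most 2ck/p. *)
have q1 : 1 <= k%:R / i0.+1%:R :> R.
  by rewrite ler_pdivlMr ?ltr0n // mul1r ler_nat.
have c0 : 0 <= c%:R :> R by [].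
rewrite -!mulrA; set q := _ / _ in q1 *.
rewrite lerXn2r ?nnegrE //; nra.
Qed.

Theorem corollary4p3 (R : realType) :
  exists2 C : R, 0 < C &
    forall (k : nat) (n : 'I_k -> nat),
      (2 <= k)%N ->
      (forall i : 'I_k, (0 < n i)%N) ->
      (forall i j : 'I_k, (i <= j)%N -> (n j <= n i)%N) ->
      ((C * \big[Num.max/0]_(i < k)
              (i.+1%:R / k%:R * Num.sqrt (n i)%:R))%:E <= cPROP R n)%E.
Proof.
(* With N = 2^t and n <= 4N, sqrt n <= 2 sqrt N <= 6 (2ck/p) = 12ck/p. *)
exists 12^-1; first by rewrite invr_gt0.
move=> k n k2 n0 nmono; apply/ereal_infP => _ [c Pc <-].
rewrite lee_fin mulrC ler_pdivrMr //; apply: bigmax_le => [|i _].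
  by rewrite mulr_ge0.
have k0 : 0 < k%:R :> R by rewrite ltr0n; lia.
have p0 : 0 < i.+1%:R :> R by [].
have c1 : 1 <= c%:R :> R by rewrite ler1n (PROP_guaranteed_gt0 k2 n0 Pc).
(* A group of size 1 leaves no room for two agents per row, but its term is at most 1 <= c. *)
have [n1|n2] := leqP (n i) 1.
  have -> : n i = 1%N by apply/eqP; rewrite eqn_leq n1 n0.
  rewrite sqrtr1 mulr1; have : i.+1%:R / k%:R <= 1 :> R.
    by rewrite ler_pdivrMr // mul1r ler_nat.
  lra.
have [t /andP[lo hi]] : exists t, (2 ^ t.+1 <= n i < 2 ^ t.+2)%N.
  exists (trunc_log 2 (n i)).-1.
  have t0 : (0 < trunc_log 2 (n i))%N by rewrite trunc_log_gt0.
  by rewrite prednK //; exact: trunc_log_bounds.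
have := @PROP_lower_bound R k n c t i k2 n0 _ Pc.
move=> /(_ (fun j ji => leq_trans lo (nmono _ _ ji))) bound.
rewrite mulrC mulrA ler_pdivrMr // -ler_pdivlMr //.
rewrite -(ler_pXn2r (n := 2)) ?nnegrE ?sqrtr_ge0 //.
rewrite sqr_sqrtr ?ler0n //.
have : (n i)%:R <= 4 * (2 ^ t)%:R :> R.
  by rewrite -natrM ler_nat (leq_trans (ltnW hi)) // !expnS mulnA.
have -> : c%:R * 12 * k%:R / i.+1%:R = 6 * (2 * c%:R * k%:R / i.+1%:R) :> R.
  by ring.
rewrite (exprMn _ 6) -natrX; move: bound.
by move: (_ ^+ 2) (2 ^ t)%:R (n i)%:R => x N m; lra.
Qed.
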